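(* Suppose that for each client $i$ the stochastic gradient $g_i(x;\xi)$ of a differentiable function $F_i:\mathbb{R}^d\to\mathbb{R}$ satisfies, for every $x\in\mathbb{R}^d$, $\mathbb{E}[g_i(x;\xi)\mid x]=\nabla F_i(x)$ and $\mathbb{E}\|g_i(x;\xi)-\nabla F_i(x)\|^2\le\sigma^2$, the noises $g_i(x;\xi)-\nabla F_i(x)$ being independent across different clients $i$. Then: 1. (Unbiasedness) $\mathbb{E}[g_i(x;\xi)\mid x]=\nabla F_i(x)$. 2. (Bounded variance) $\mathbb{E}[\|g_i(x;\xi)-\nabla F_i(x)\|^2\mid x]\le\sigma^2$. 3. (Bounded second moment) $\mathbb{E}[\|g_i(x;\xi)\|^2\mid x]\le\|\nabla F_i(x)\|^2+\sigma^2$. 4. (Projected variance) For any fixed matrix $P$ (or random matrix $P$ independent of $\xi$) with spectral norm $\|P\|_2\le1$, $$\mathbb{E}[\|P(g_i(x;\xi)-\nabla F_i(x))\|^2\mid x,P]\le\sigma^2.$$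
   Context: $g_i(x;\xi)\in\mathbb{R}^d$ is the stochastic gradient computed by client $i$ at the model parameter $x\in\mathbb{R}^d$ with random sample $\xi$. Conditioning on $x$ means that $x$ is held fixed and the expectation is over $\xi$. $\|\cdot\|$ is the Euclidean norm; $P$ is any real matrix with $d$ columns. *)

(* Defs.v *)
From HB Require Import structures.
From mathcomp Require Import all_boot all_order all_algebra.
From mathcomp Require Import all_classical all_reals all_analysis.

Set Implicit Arguments.
Unset Strict Implicit.
Unset Printing Implicit Defensive.

Import Order.TTheory GRing.Theory Num.Theory.
Import numFieldNormedType.Exports.

Local Open Scope classical_set_scope.
Local Open Scope ring_scope.

(* Vectors of R^n are column vectors.  The library norm on matrices is the
   max norm; it is only used, through the (equivalent) topology it induces,
   for differentiability and Borel sets. *)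
Definition enorm (R : realType) (n : nat) (v : 'cV[R]_n) : R :=
  Num.sqrt (\sum_(j < n) v j 0 ^+ 2).

(* Operator norm induced by the Euclidean norms.  The set is nonempty and
   bounded above, so this [sup] is the genuine supremum. *)
Definition spectral_norm (R : realType) (m n : nat) (M : 'M[R]_(m, n)) : R :=
  sup [set enorm (M *m v) | v in [set v : 'cV[R]_n | enorm v <= 1]].

Definition grad (R : realType) (n : nat) (F : 'cV[R]_n -> R) (x : 'cV[R]_n) :
    'cV[R]_n :=
  \col_(j < n) 'D_(delta_mx j 0) F x.

(* 'M[R]_(m, n) equipped with its Borel sigma-algebra. *)
Definition mx_borel (R : realType) (m n : nat) :=
  g_sigma_algebraType (@open 'M[R]_(m, n)).

Section Probability.
Context (d : measure_display) (T : measurableType d) (R : realType)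
  (Pr : probability T R).

(* v is the (componentwise) expectation of the random vector X, each
   component of X being integrable. *)
Definition has_mean (n : nat) (X : T -> 'cV[R]_n) (v : 'cV[R]_n) : Prop :=
  forall j : 'I_n,
    Pr.-integrable [set: T] (fun w => (X w j ord0)%:E) /\
    ('E_Pr[fun w => X w j ord0] = (v j ord0)%:E)%E.

Definition mutually_independent (I : finType) (d' : measure_display)
    (S : measurableType d') (X : I -> T -> S) : Prop :=
  forall (J : {set I}) (A : I -> set S),
    (forall i, i \in J -> measurable (A i)) ->
    Pr (\bigcap_(i in [set` J]) (X i @^-1` A i)) =
    (\prod_(i in J) Pr (X i @^-1` A i))%E.

Definition independent_pair (d1 d2 : measure_display)
    (S1 : measurableType d1) (S2 : measurableType d2)
    (X : T -> S1) (Y : T -> S2) : Prop :=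
  forall (A : set S1) (B : set S2), measurable A -> measurable B ->
    Pr (X @^-1` A `&` Y @^-1` B) = (Pr (X @^-1` A) * Pr (Y @^-1` B))%E.

(* Y is a version of E[Z | X], the conditional expectation of Z given the
   sigma-algebra generated by X. *)
Definition is_cond_expectation (d' : measure_display) (S : measurableType d')
    (X : T -> S) (Z Y : T -> R) : Prop :=
  [/\ Pr.-integrable [set: T] (EFin \o Z),
      Pr.-integrable [set: T] (EFin \o Y),
      measurable_fun [set: g_sigma_algebra_preimageType X] Y &
      forall A : set T, g_sigma_algebra_preimage X A ->
        (\int[Pr]_(w in A) (Y w)%:E = \int[Pr]_(w in A) (Z w)%:E)%E].

End Probability.

(* Main.v *)
(** Write N = g_i(x; xi) - grad F_i(x), which has mean zero.  The second moment
    bound is the expansion of ||N + a||^2, whose cross term vanishes, and the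
    bound for a fixed P is ||P v|| <= ||P||_2 ||v||.  For a random P, the
    conditional expectation exists by the Radon-Nikodym theorem.  For every
    event A = (P \in B), the pointwise bound ||P N||^2 <= ||N||^2 and the
    independence of P and xi give E[1_A ||P N||^2] <= Pr(A) E||N||^2
    <= sigma^2 Pr(A); taking A = (Y > sigma^2) for a version Y of the
    conditional expectation forces Pr(A) = 0. *)

Require Import Defs.
From HB Require Import structures.
From mathcomp Require Import all_boot all_order all_algebra.
From mathcomp Require Import all_classical all_reals all_analysis.
From mathcomp Require Import measurable_realfun ring.

Set Implicit Arguments.
Unset Strict Implicit.
Unset Printing Implicit Defensive.

Import Order.TTheory GRing.Theory Num.Theory.
Import numFieldNormedType.Exports.

Local Open Scope classical_set_scope.
Local Open Scope ring_scope.

(** * Euclidean norm and spectral norm *)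

Lemma sqr_enorm (R : realType) (n : nat) (v : 'cV[R]_n) :
  enorm v ^+ 2 = \sum_(j < n) v j 0 ^+ 2.
Proof. by rewrite sqr_sqrtr // sumr_ge0 // => j _; exact: sqr_ge0. Qed.

Lemma enorm_ge0 (R : realType) (n : nat) (v : 'cV[R]_n) : 0 <= enorm v.
Proof. exact: sqrtr_ge0. Qed.

Lemma enorm0 (R : realType) (n : nat) : enorm (0 : 'cV[R]_n) = 0.
Proof.
by rewrite /enorm big1 ?sqrtr0 // => j _; rewrite mxE expr0n.
Qed.

Lemma enormZ (R : realType) (n : nat) (a : R) (v : 'cV[R]_n) :
  0 <= a -> enorm (a *: v) = a * enorm v.
Proof.
move=> a0; apply: (pexpIrn (n := 2)) => //.
- by rewrite nnegrE enorm_ge0.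
- by rewrite nnegrE mulr_ge0 // enorm_ge0.
rewrite exprMn !sqr_enorm mulr_sumr.
by apply: eq_bigr => j _; rewrite mxE exprMn.
Qed.

Lemma enorm_eq0 (R : realType) (n : nat) (v : 'cV[R]_n) : enorm v = 0 -> v = 0.
Proof.
move=> v0; have /eqP := sqr_enorm v; rewrite v0 expr0n eq_sym.
rewrite psumr_eq0 => [/allP h|j _]; last exact: sqr_ge0.
apply/matrixP => j k; rewrite (ord1 k) mxE.
by have /= := h j (mem_index_enum _); rewrite sqrf_eq0 => /eqP.
Qed.

Lemma enorm_coord_le (R : realType) (n : nat) (v : 'cV[R]_n) (j : 'I_n) :
  `|v j 0| <= enorm v.
Proof.
rewrite -ler_sqr ?nnegrE ?enorm_ge0 // real_normK ?num_real // sqr_enorm.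
by rewrite (bigD1 j) //= lerDl sumr_ge0 // => k _; exact: sqr_ge0.
Qed.

(** Coordinates of a vector in the unit ball are at most 1 in absolute value, so each entry of
    [M *m v] is bounded by an absolute row sum of [M]. *)
Lemma has_ubound_spectral (R : realType) (m n : nat) (M : 'M[R]_(m, n)) :
  has_ubound [set enorm (M *m v) | v in [set v : 'cV[R]_n | enorm v <= 1]].
Proof.
exists (Num.sqrt (\sum_(i < m) (\sum_(j < n) `|M i j|) ^+ 2)).
move=> _ [v /= v1 <-]; apply: ler_wsqrtr; apply: ler_sum => i _.
rewrite -real_normK ?num_real //; apply: lerXn2r; rewrite ?nnegrE ?sumr_ge0 //.
rewrite mxE (le_trans (ler_norm_sum _ _ _)) //; apply: ler_sum => j _.
by rewrite normrM ler_piMr // (le_trans (enorm_coord_le v j)).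
Qed.

(** By homogeneity it suffices to treat [v] divided by its norm, which lies in the unit ball; the
    zero vector is treated apart. *)
Lemma enorm_mulmx_le (R : realType) (m n : nat) (M : 'M[R]_(m, n))
    (v : 'cV[R]_n) :
  enorm (M *m v) <= spectral_norm M * enorm v.
Proof.
have [v0|v0] := eqVneq (enorm v) 0.
  by rewrite (enorm_eq0 v0) mulmx0 !enorm0 mulr0.
have vp : 0 < enorm v by rewrite lt_def v0 enorm_ge0.
rewrite -ler_pdivrMr // mulrC -enormZ ?invr_ge0 ?enorm_ge0 //.
rewrite scalemxAr; apply: ub_le_sup; first exact: has_ubound_spectral.
exists ((enorm v)^-1 *: v) => //=.
by rewrite enormZ ?invr_ge0 ?enorm_ge0 // mulVf.
Qed.

Lemma sqr_enorm_mulmx_le (R : realType) (m n : nat) (M : 'M[R]_(m, n))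
    (v : 'cV[R]_n) :
  spectral_norm M <= 1 -> enorm (M *m v) ^+ 2 <= enorm v ^+ 2.
Proof.
move=> M1; apply: lerXn2r; rewrite ?nnegrE ?enorm_ge0 //.
by rewrite (le_trans (enorm_mulmx_le M v)) // ler_piMl ?enorm_ge0.
Qed.

(** * Measurability of coordinates and of squared norms *)

Lemma measurable_preimage (d d' : measure_display) (T : measurableType d)
    (S : measurableType d') (f : T -> S) (B : set S) :
  measurable_fun [set: T] f -> measurable B -> measurable (f @^-1` B).
Proof. by move=> mf mB; rewrite -[X in measurable X]setTI; exact: mf. Qed.

(** Open intervals generate the Borel sets of the line, and their preimages under the continuous
    coordinate maps are open. *)
Lemma measurable_mx_coord (d : measure_display) (T : measurableType d)
    (R : realType) (m n : nat) (X : T -> 'M[R]_(m, n)) (i : 'I_m) (j : 'I_n) :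
  measurable_fun [set: T] (X : T -> mx_borel R m n) ->
  measurable_fun [set: T] (fun w => X w i j).
Proof.
move=> mX; apply: (measurability _ (RGenOpens.measurableE R)) => _ [_ [a [b ->] <-]].
rewrite setTI -[X in measurable X]/(X @^-1` ((fun M => M i j) @^-1` `]a, b[)).
apply: measurable_preimage mX _; apply: sub_sigma_algebra.
have /continuousP := @coord_continuous R m n i j.
by apply; exact: interval_open.
Qed.

Lemma measurable_sqr_enorm (d : measure_display) (T : measurableType d)
    (R : realType) (n : nat) (X : T -> 'cV[R]_n) :
  (forall j, measurable_fun [set: T] (fun w => X w j 0)) ->
  measurable_fun [set: T] (fun w => enorm (X w) ^+ 2).
Proof.
move=> mX; under eq_fun do rewrite sqr_enorm.
by apply: measurable_sum => j; exact: measurable_funX.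
Qed.

Lemma measurable_sqr_enorm_mulmx (d : measure_display) (T : measurableType d)
    (R : realType) (m n : nat) (P : T -> 'M[R]_(m, n)) (X : T -> 'cV[R]_n) :
  (forall i j, measurable_fun [set: T] (fun w => P w i j)) ->
  (forall j, measurable_fun [set: T] (fun w => X w j 0)) ->
  measurable_fun [set: T] (fun w => enorm (P w *m X w) ^+ 2).
Proof.
move=> mP mX; apply: measurable_sqr_enorm => i.
under eq_fun do rewrite mxE.
by apply: measurable_sum => j; exact: measurable_funM.
Qed.

(** * Integrability and second moments *)

Lemma integrable_of_ge0_le (d : measure_display) (T : measurableType d)
    (R : realType) (mu : {measure set T -> \bar R}) (f : T -> R) (c : R) :
  measurable_fun [set: T] f -> (forall w, 0 <= f w) ->
  (\int[mu]_w (f w)%:E <= c%:E)%E -> mu.-integrable [set: T] (EFin \o f).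
Proof.
move=> mf f0 fc; apply/integrableP; split; first exact/measurable_EFinP.
under eq_integral do rewrite /= ger0_norm //.
exact: le_lt_trans fc (ltry _).
Qed.

Lemma expectation_sqr_enorm (d : measure_display) (T : measurableType d)
    (R : realType) (Pr : probability T R) (n : nat) (X : T -> 'cV[R]_n)
    (a : 'cV[R]_n) :
  has_mean Pr X a ->
  Pr.-integrable [set: T] (EFin \o (fun w => enorm (X w - a) ^+ 2)) ->
  ('E_Pr[fun w => (enorm (X w) ^+ 2)%R] =
   'E_Pr[fun w => (enorm (X w - a) ^+ 2)%R] + (enorm a ^+ 2)%:E)%E.
Proof.
move=> Xa intN; rewrite !expectation.unlock.
(* The cross term is expanded into twice the inner product of [a] and [X], minus the squared norm of
   [a], so that only integrals of coordinates of [X] occur, which [has_mean] provides. *)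
have E w : (enorm (X w) ^+ 2)%:E =
   ((enorm (X w - a) ^+ 2)%:E +
    ((\sum_(j < n) (2 * a j 0)%:E * (X w j 0)%:E) + (- enorm a ^+ 2)%:E))%E.
  under eq_bigr do rewrite -EFinM.
  rewrite sumEFin -!EFinD; congr (_%:E).
  rewrite !sqr_enorm -sumrN -!big_split /=.
  by apply: eq_bigr => j _; rewrite !mxE; ring.
under eq_integral do rewrite E.
have intX j : Pr.-integrable setT
    (fun w => ((2 * a j 0)%:E * (X w j 0)%:E)%E).
  by apply: integrableZl => //; exact: (Xa j).1.
have intS : Pr.-integrable setT
    (fun w => (\sum_(j < n) (2 * a j 0)%:E * (X w j 0)%:E)%E).
  exact: integrable_sum.
have intc c : Pr.-integrable setT (fun=> c%:E).
  by apply: finite_measure_integrable_cst.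
rewrite integralD //; last by apply: integrableD.
rewrite integralD // integral_cst // [X in (_ * X)%E]probability_setT mule1.
rewrite integral_sum //.
under eq_bigr => j _.
  rewrite integralZl //; last exact: (Xa j).1.
  have := (Xa j).2; rewrite expectation.unlock => ->; rewrite -EFinM.
  over.
rewrite sumEFin -EFinD; congr (_ + _%:E)%E.
rewrite sqr_enorm -sumrN -big_split /=.
by apply: eq_bigr => j _; ring.
Qed.

(** * Conditional expectations: existence and upper bounds *)

(* Y is the density of the image under X of the charge Z.Pr with respect to the
   law of X, composed with X. *)
Lemma cond_expectation_exists (d d' : measure_display) (T : measurableType d)
    (S : measurableType d') (R : realType) (Pr : probability T R)
    (X : T -> S) (Z : T -> R) :
  measurable_fun [set: T] X -> Pr.-integrable [set: T] (EFin \o Z) ->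
  exists Y : T -> R, is_cond_expectation Pr X Z Y.
Proof.
move=> mX intZ.
pose X' : {mfun T >-> S} := HB.pack X (isMeasurableFun.Build _ _ _ _ _ mX).
pose mu := distribution Pr X'.
pose nu := pushforward (induced_charge intZ) X'.
(* The integral of [Z] over a [Pr]-null set is zero, and domination passes to image measures. *)
have nu_mu : nu `<< mu.
  apply: dominates_pushforward => //.
  apply/null_content_dominatesP => A mA PA0; apply: null_set_integral => //.
  by apply: measurable_funTS; exact: measurable_int intZ.
(* The charge structure of [nu] depends on the measurability of X, so that [f0]
   is still a function of a proof of it. *)
pose f0 := Radon_Nikodym nu mu; pose f := f0 mX.
have intf : mu.-integrable setT f by exact: Radon_Nikodym_integrable.
have mf : measurable_fun setT f by exact: measurable_int intf.
have mfine : measurable_fun setT (fine \o f) by exact: measurableT_comp.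
have fK x : (fine (f x))%:E = f x by rewrite fineK // Radon_Nikodym_fin_num.
have intY : Pr.-integrable setT (f \o X).
  apply/integrableP; split; first exact: measurableT_comp.
  have /integrableP[_] := intf.
  rewrite /mu /distribution ge0_integral_pushforward //.
  exact: measurableT_comp.
exists (fine \o f \o X); split => //.
- by rewrite (_ : _ \o _ = f \o X) //; apply/funext => w /=; rewrite fK.
- move=> _ B mB; exists ((fine \o f) @^-1` B); last by rewrite setTI.
  exact: measurable_preimage.
move=> _ [B mB <-]; rewrite setTI.
under eq_integral do rewrite /= fK.
have mXB : measurable (X @^-1` B) by exact: measurable_preimage.
rewrite -(integral_pushforward mX (f := f)) //; last exact: integrableS intY.
exact/esym/(Radon_Nikodym_integral nu_mu mB).
Qed.

Lemma cond_expectation_le (d d' : measure_display) (T : measurableType d)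
    (S : measurableType d') (R : realType) (Pr : probability T R)
    (X : T -> S) (Z Y : T -> R) (c : R) :
  measurable_fun [set: T] X -> is_cond_expectation Pr X Z Y ->
  (forall B, measurable B ->
    (\int[Pr]_(w in X @^-1` B) (Z w)%:E <= c%:E * Pr (X @^-1` B))%E) ->
  {ae Pr, forall w, Y w <= c}.
Proof.
move=> mX [_ intY mY YZ] Zc.
have [B mB BE] : g_sigma_algebra_preimage X (Y @^-1` `]c, +oo[).
  rewrite -[X in g_sigma_algebra_preimage _ X]setTI.
  exact: mY measurableT _ (measurable_itv _).
rewrite setTI in BE.
have mA : measurable (X @^-1` B) by exact: measurable_preimage.
have intYA : Pr.-integrable (X @^-1` B) (EFin \o Y) by exact: integrableS intY.
have intcA : Pr.-integrable (X @^-1` B) (fun=> c%:E).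
  exact: finite_measure_integrable_cst.
have YcA w : (X @^-1` B) w -> (0 <= (Y w)%:E - c%:E)%E.
  by rewrite BE /= in_itv /= andbT -EFinB lee_fin subr_ge0 => /ltW.
(* On this event [Y - c] is nonnegative, yet its integral is at most 0 because [Y] and [Z] have the
   same integral there. *)
have intD0 : (\int[Pr]_(w in X @^-1` B) `|(Y w)%:E - c%:E| = 0)%E.
  under eq_integral => w /[!inE] wA do rewrite gee0_abs ?YcA//.
  apply/eqP; rewrite eq_le integral_ge0 // andbT integralB //.
  rewrite integral_cst // leeBlDr ?fin_numM ?fin_num_measure //.
  rewrite add0e YZ; last by exists B => //; rewrite setTI.
  exact: Zc.
have mD : measurable_fun (X @^-1` B) (fun w => (Y w)%:E - c%:E)%E.
  exact: measurable_int (integrableB mA intYA intcA).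
(* Hence [Y = c] almost everywhere on an event where [Y > c], so the event is negligible. *)
have Yc0 := (ae_eq_integral_abs Pr mA mD).1 intD0.
apply: filterS Yc0 => w Yc0; rewrite leNgt; apply/negP => cY.
have /Yc0 /eqP : (X @^-1` B) w by rewrite BE /= in_itv /= cY.
by rewrite -EFinB eqe subr_eq0 gt_eqF.
Qed.

(** * Factorization of integrals under independence *)

Lemma independent_integral (d d1 d2 : measure_display) (T : measurableType d)
    (S1 : measurableType d1) (S2 : measurableType d2) (R : realType)
    (Pr : probability T R) (X : T -> S1) (Y : T -> S2) (h : S2 -> \bar R)
    (B : set S1) :
  measurable_fun [set: T] X -> measurable_fun [set: T] Y ->
  independent_pair Pr X Y -> measurable_fun [set: S2] h ->
  (forall s, 0 <= h s)%E -> measurable B ->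
  (\int[Pr]_(w in X @^-1` B) h (Y w) =
   Pr (X @^-1` B) * \int[Pr]_w h (Y w))%E.
Proof.
move=> mX mY indep mh h0 mB.
have mA : measurable (X @^-1` B) by exact: measurable_preimage.
(* The scaling factor of [mscale] is a nonnegative real, so the probability passes through
   [fine]. *)
have p0 : 0 <= fine (Pr (X @^-1` B)) by exact: fine_ge0.
pose p := NngNum p0.
(* Independence says that the law of Y under the restriction of Pr to the event
   is the law of Y scaled by the probability of that event. *)
pose PA := mrestr Pr mA.
have PA_compl : PA (~` (X @^-1` B)) = 0 by rewrite /PA /mrestr setICl measure0.
(* The restricted measure does not charge the complement of the event, so integrating over the whole
   space changes nothing. *)
transitivity (\int[PA]_w h (Y w))%E.
  rewrite [RHS](ge0_negligible_integral _ _ _ _ PA_compl) //; last 2 first.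
  - exact: measurableC.
  - exact: measurableT_comp.
  rewrite setTD setCK; apply: eq_measure_integral => C mC CA.
  by rewrite /PA /= /mrestr setIidl.
have hge0 : {in [set: S2], forall s, 0 <= h s}%E by [].
apply: etrans (esym (ge0_integral_pushforward mY PA measurableT mh hge0)) _.
have := ge0_integral_pushforward mY Pr measurableT mh hge0.
rewrite preimage_setT => <-.
rewrite -[X in (X * _)%E](@fineK _ (Pr (X @^-1` B))) ?fin_num_measure //.
rewrite -(ge0_integral_mscale _ _ p) //.
apply: eq_measure_integral => C mC _.
rewrite /PA /= /pushforward /mrestr /mscale /= fineK ?fin_num_measure //.
by rewrite setIC indep.
Qed.

(** * Moment bounds for the stochastic gradients *)

Unset Implicit Arguments.

Theorem lemma1 (R : realType)
  (dO : measure_display) (Omega : measurableType dO) (Pr : probability Omega R)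
  (dX : measure_display) (Xi : measurableType dX) (xi : Omega -> Xi)
  (hxi : measurable_fun [set: Omega] xi)
  (I : finType) (d : nat)
  (F : I -> 'cV[R]_d -> R)
  (hF : forall (i : I) (x : 'cV[R]_d), differentiable (F i) x)
  (g : I -> 'cV[R]_d -> Xi -> 'cV[R]_d)
  (hg : forall (i : I) (x : 'cV[R]_d),
      measurable_fun [set: Xi] (g i x : Xi -> mx_borel R d 1))
  (sigma : R)
  (hmean : forall (i : I) (x : 'cV[R]_d),
      has_mean Pr (fun w => g i x (xi w)) (grad (F i) x))
  (hvar : forall (i : I) (x : 'cV[R]_d),
      ('E_Pr[fun w => (enorm (g i x (xi w) - grad (F i) x) ^+ 2)%R]
        <= (sigma ^+ 2)%:E)%E)
  (hindep : forall x : 'cV[R]_d,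
      mutually_independent Pr
        (fun (i : I) (w : Omega) =>
           (g i x (xi w) - grad (F i) x : mx_borel R d 1))) :
  forall (i : I) (x : 'cV[R]_d),
  [/\ (* unbiasedness *)
      has_mean Pr (fun w => g i x (xi w)) (grad (F i) x),
      (* bounded variance *)
      ('E_Pr[fun w => (enorm (g i x (xi w) - grad (F i) x) ^+ 2)%R]
        <= (sigma ^+ 2)%:E)%E,
      (* bounded second moment *)
      ('E_Pr[fun w => (enorm (g i x (xi w)) ^+ 2)%R]
        <= (enorm (grad (F i) x) ^+ 2 + sigma ^+ 2)%:E)%E,
      (* projected variance, fixed matrix *)
      forall (m : nat) (P : 'M[R]_(m, d)), spectral_norm P <= 1 ->
        ('E_Pr[fun w => (enorm (P *m (g i x (xi w) - grad (F i) x)) ^+ 2)%R]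
          <= (sigma ^+ 2)%:E)%E
    & (* projected variance, random matrix independent of the sample *)
      forall (m : nat) (P : Omega -> 'M[R]_(m, d)),
        measurable_fun [set: Omega] (P : Omega -> mx_borel R m d) ->
        independent_pair Pr (P : Omega -> mx_borel R m d) xi ->
        {ae Pr, forall w, spectral_norm (P w) <= 1} ->
        let Z := fun w : Omega =>
          enorm (P w *m (g i x (xi w) - grad (F i) x)) ^+ 2 in
        (exists Y : Omega -> R,
          is_cond_expectation Pr (P : Omega -> mx_borel R m d) Z Y) /\
        (forall Y : Omega -> R,
          is_cond_expectation Pr (P : Omega -> mx_borel R m d) Z Y ->
          {ae Pr, forall w, Y w <= sigma ^+ 2})].

Proof.
(* The noise [N] is a function of the sample alone, so that independence of [P] and [xi] can be
   applied to its squared norm. *)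
move=> i x; set a := grad (F i) x; pose N s := g i x s - a.
have mNj j : measurable_fun [set: Xi] (fun s => N s j 0).
  rewrite (_ : (fun s => N s j 0) = (fun s => g i x s j 0 - a j 0)); last first.
    by apply/funext => s; rewrite !mxE.
  apply: measurable_funB => //.
  exact: measurable_mx_coord (hg i x).
have mNxij j : measurable_fun [set: Omega] (fun w => N (xi w) j 0).
  exact: (measurableT_comp (mNj j) hxi).
have mN2 : measurable_fun [set: Xi] (fun s => enorm (N s) ^+ 2).
  exact: measurable_sqr_enorm.
have mNxi2 : measurable_fun [set: Omega] (fun w => enorm (N (xi w)) ^+ 2).
  exact: measurable_sqr_enorm.
have N2le : (\int[Pr]_w (enorm (N (xi w)) ^+ 2)%:E <= (sigma ^+ 2)%:E)%E.
  by have := hvar i x; rewrite expectation.unlock.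
have intN2 : Pr.-integrable [set: Omega] (EFin \o (fun w => enorm (N (xi w)) ^+ 2)).
  by apply: integrable_of_ge0_le N2le => // w; exact: sqr_ge0.
split; [exact: hmean|exact: hvar| | |].
- by rewrite (expectation_sqr_enorm (hmean i x)) // addeC EFinD leeD2l //.
- move=> m P P1; apply: le_trans (hvar i x).
  apply: expectation_le => //.
  + exact: measurable_sqr_enorm_mulmx.
  + by move=> w; exact: sqr_ge0.
  + by move=> w; exact: sqr_ge0.
  + by apply: aeW => w; exact: sqr_enorm_mulmx_le.
move=> m P mP indP P1 Z.
have mPij k j : measurable_fun [set: Omega] (fun w => P w k j).
  exact: measurable_mx_coord mP.
have mZ : measurable_fun [set: Omega] Z by exact: measurable_sqr_enorm_mulmx.
(* The spectral bound on [P] holds only almost surely, which is enough to compare integrals over any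
   event. *)
have ZleN (A : set Omega) : measurable A ->
    (\int[Pr]_(w in A) (Z w)%:E <= \int[Pr]_(w in A) (enorm (N (xi w)) ^+ 2)%:E)%E.
  move=> mA; apply: ae_ge0_le_integral => //.
  + by move=> w _; rewrite lee_fin sqr_ge0.
  + exact/measurable_funTS/measurable_EFinP.
  + by move=> w _; rewrite lee_fin sqr_ge0.
  + exact/measurable_funTS/measurable_EFinP.
  + apply: filterS P1 => w Pw1 _.
    by rewrite lee_fin; exact: sqr_enorm_mulmx_le.
split=> [|Y condY].
  apply: cond_expectation_exists => //.
  apply: (@integrable_of_ge0_le _ _ _ _ _ (sigma ^+ 2)) => //.
    by move=> w; exact: sqr_ge0.
  exact: le_trans (ZleN _ measurableT) N2le.
apply: (cond_expectation_le mP condY) => B mB.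
have mA := measurable_preimage mP mB.
apply: le_trans (ZleN _ mA) _.
rewrite (independent_integral (h := fun s => (enorm (N s) ^+ 2)%:E) mP hxi indP) //.
- by rewrite muleC lee_wpmul2r.
- exact/measurable_EFinP.
- by move=> s; rewrite lee_fin sqr_ge0.
Qed.
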